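(* Let $\vec r_1(t),\vec r_2(t),\vec r_3(t)$ be three points in the plane, $\vec r_i(t)=(x_i(t),y_i(t))$, moving along continuously differentiable curves so that at every moment of time, for each $i=1,2,3$ (indices mod $3$), the velocity $\dot{\vec r}_i$ is parallel to $\vec r_{i+1}-\vec r_{i+2}$, in the sense that $$(y_{i+1}-y_{i+2})\,\dot x_i-(x_{i+1}-x_{i+2})\,\dot y_i=0,\qquad i=1,2,3.$$ Then the triangle with vertices $\vec r_1(t),\vec r_2(t),\vec r_3(t)$ has the same area at every moment of time.
   Context: The stated constraint is called Rule B for the motion of three ''ants'' $\vec r_1,\vec r_2,\vec r_3$ in the plane. *)

(* Defs.v *)
From HB Require Import structures.
From mathcomp Require Export all_boot all_order all_algebra.
From mathcomp Require Export all_classical all_reals all_analysis.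
Export Order.TTheory GRing.Theory Num.Theory.
Export numFieldNormedType.Exports.

Set Implicit Arguments.
Unset Strict Implicit.
Unset Printing Implicit Defensive.

Local Open Scope classical_set_scope.
Local Open Scope ring_scope.

(* Limits and continuity are taken relative to the time interval I, so the
   derivative is the usual two-sided one at interior points of I and the
   one-sided one at endpoints belonging to I. *)
Definition continuously_differentiable_on (R : realType) (I : set R)
    (r v : R -> R^o * R^o) : Prop :=
  (forall t, I t ->
     (fun s => (s - t)^-1 *: (r s - r t)) @ within I t^' --> v t) /\
  {within I, continuous v}.

(* The indices live in the cyclic group 'Z_3, so i + 1 and i + 2 are mod 3. *)
Definition ruleB (R : realType) (r v : 'Z_3 -> R -> R^o * R^o) (t : R) : Prop :=
  forall i : 'Z_3,
    ((r (i + 1) t).2 - (r (i + 2) t).2) * (v i t).1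
    - ((r (i + 1) t).1 - (r (i + 2) t).1) * (v i t).2 = 0.

Definition triangle (R : realType) (a b c : R^o * R^o) : set (R^o * R^o) :=
  [set p | exists x y z : R,
     [/\ 0 <= x, 0 <= y, 0 <= z, x + y + z = 1
       & p = x *: a + y *: b + z *: c]].

Definition area (R : realType) (A : set (R^o * R^o)) : \bar R :=
  (@lebesgue_measure R \x @lebesgue_measure R)%E A.

(* Main.v *)
(* Twice the signed area of the triangle is sum_i x_i (y_{i+1} - y_{i+2}); its
   time derivative is the sum of the three Rule B expressions, so it vanishes
   and the signed area is constant on the interval.  The Lebesgue measure of the
   triangle depends only on this number: planar measure is invariant under
   vertical shears (translation invariance on vertical sections) and under
   exchange of the coordinates (Fubini), these maps reduce a nondegenerate
   triangle to the one with vertices (0, 0), (1, 0), (0, d), and a degenerate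
   triangle lies on a line. *)
Require Import Defs.
From mathcomp Require Import measurable_realfun ring.
Local Open Scope classical_set_scope.
Local Open Scope ring_scope.

Lemma lebesgue_measure_translation {R : realType} (k : R)
    (A : set (measurableTypeR R)) : measurable A ->
  lebesgue_measure ((fun y : R => y + k) @^-1` A) = lebesgue_measure A.
Proof.
have mf : measurable_fun [set: measurableTypeR R]
    ((fun y : R => y + k) : measurableTypeR R -> measurableTypeR R).
  by apply: measurable_funD.
move=> mA; apply/esym.
pose m : {measure set (measurableTypeR R) -> \bar R} :=
  measure_function_pushforward__canonical__measure_function_Measure lebesgue_measure mf.
apply: (@lebesgue_measure_unique R m) mA => _ [[a b] _ <-] /=.
rewrite /m /= /pushforward (_ : _ @^-1` _ = `]a - k, b - k]%classic); last first.
  by apply/seteqP; split=> y /=; rewrite !in_itv /= ltrBlDr lerBrDr.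
rewrite !lebesgue_measure_itv /= !lte_fin ltrD2r.
by case: ifP => // _; rewrite -!EFinB; congr (_%:E); ring.
Qed.

Lemma area_fiber_translation {R : realType} (A B : set (R^o * R^o)) (k : R -> R) :
    measurable (A : set (measurableTypeR R * measurableTypeR R)) ->
    (forall x y, B (x, y) <-> A (x, y + k x)) ->
  area B = area A.
Proof.
move=> mA AB; rewrite /area /product_measure1.
apply: eq_integral => x _ /=.
rewrite -[RHS](lebesgue_measure_translation (k x)); last exact: measurable_xsection.
congr (lebesgue_measure _); apply/seteqP; split=> y /=.
  by rewrite /xsection/= !inE => /AB.
by rewrite /xsection/= !inE => ?; apply/AB.
Qed.

Lemma area_swap {R : realType} (A B : set (R^o * R^o)) :
    measurable (A : set (measurableTypeR R * measurableTypeR R)) ->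
    (forall x y, B (x, y) <-> A (y, x)) ->
  area B = area A.
Proof.
move=> mA AB; rewrite /area.
rewrite [RHS](@product_measure_unique _ _ _ _ _ _ _
  (@lebesgue_measure R \x^ @lebesgue_measure R)%E _ A) //; last first.
  by move=> X Y mX mY; exact: product_measure2E.
rewrite /product_measure1 /product_measure2; apply: eq_integral => x _ /=.
congr (lebesgue_measure _); apply/seteqP; split=> y /=.
  by rewrite /xsection/ysection/= !inE => /AB.
by rewrite /xsection/ysection/= !inE => ?; apply/AB.
Qed.

Lemma area_sub_line {R : realType} (A : set (R^o * R^o)) (a b c : R) :
    (a != 0) || (b != 0) ->
    (forall p, A p -> a * p.1 + b * p.2 = c) ->
  area A = 0%E.
Proof.
move=> ab Aline; rewrite /area /product_measure1.
have [b0|b0] := eqVneq b 0.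
  have {ab} a0 : a != 0 by move: ab; rewrite b0 eqxx orbF.
  rewrite -[RHS](integral_set1 (fun x : R => lebesgue_measure (xsection A x)) (c / a)).
  rewrite [RHS]integral_mkcond; apply: eq_integral => x _ /=.
  rewrite patchE; case: ifPn => // /negP xca.
  rewrite (_ : xsection A x = set0) ?measure0//.
  apply/seteqP; split=> y //=; rewrite /xsection/= inE => /Aline /= E.
  apply: xca; rewrite inE /= -E b0; field; exact: a0.
apply: integral0_eq => x _ /=.
have : xsection A x `<=` [set (c - a * x) / b].
  by move=> y /=; rewrite /xsection/= inE => /Aline /= <-; field.
move=> /subset_set1[] ->; first by rewrite measure0.
by rewrite lebesgue_measure_set1.
Qed.

(* This is twice the usual signed area. *)
Definition signed_area {R : realType} (a b c : R^o * R^o) : R :=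
  (b.1 - a.1) * (c.2 - a.2) - (b.2 - a.2) * (c.1 - a.1).

Lemma measurable_triangle {R : realType} (a b c : R^o * R^o) :
    signed_area a b c != 0 ->
  measurable (triangle a b c : set (measurableTypeR R * measurableTypeR R)).
Proof.
set d := signed_area a b c => d0.
have dE : d = (b.1 - a.1) * (c.2 - a.2) - (b.2 - a.2) * (c.1 - a.1) by [].
have halfplane (u v w : R) :
    measurable [set p : measurableTypeR R * measurableTypeR R | 0 <= u * p.1 + v * p.2 + w].
  have mf : measurable_fun [set: measurableTypeR R * measurableTypeR R]
      (fun p : measurableTypeR R * measurableTypeR R => u * p.1 + v * p.2 + w).
    by apply: measurable_funD => //; apply: measurable_funD; apply: measurable_funM => //.
  rewrite (_ : [set p | _] = [set: measurableTypeR R * measurableTypeR R] `&`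
    (fun p : measurableTypeR R * measurableTypeR R => u * p.1 + v * p.2 + w) @^-1` `[0, +oo[).
    by apply: mf => //; exact: measurable_itv.
  by apply/seteqP; split=> p /=; rewrite in_itv /= andbT => // -[].
have mh (f : R -> R -> R) u v w : (forall x y, f x y = u * x + v * y + w) ->
    measurable [set p : measurableTypeR R * measurableTypeR R | 0 <= f p.1 p.2].
  move=> fE; rewrite (_ : [set p | _] = [set p : measurableTypeR R * measurableTypeR R |
     0 <= u * p.1 + v * p.2 + w]); first exact: halfplane.
  by apply/seteqP; split=> p /=; rewrite fE.
pose bary (b c : R^o * R^o) (x y : R) := signed_area (x, y) b c / d.
have mb (b' c' : R^o * R^o) :
    measurable [set p : measurableTypeR R * measurableTypeR R | 0 <= bary b' c' p.1 p.2].
  apply: (mh _ ((b'.2 - c'.2) / d) ((c'.1 - b'.1) / d)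
    ((b'.1 * c'.2 - b'.2 * c'.1) / d)) => x y.
  by rewrite /bary /signed_area /=; field.
rewrite (_ : triangle a b c =
  [set p | 0 <= bary b c p.1 p.2] `&` [set p | 0 <= bary c a p.1 p.2] `&`
  [set p | 0 <= bary a b p.1 p.2]); first exact:
  (measurableI _ _ (measurableI _ _ (mb b c) (mb c a)) (mb a b)).
apply/seteqP; split=> [p [x [y [z [x0 y0 z0 xyz ->]]]]|[p q] /= [[x0 y0] z0]].
  have xE : x = 1 - y - z by rewrite -xyz; ring.
  rewrite /= /bary /signed_area /=.
  have -> : (b.1 - (x * a.1 + y * b.1 + z * c.1)) * (c.2 - (x * a.2 + y * b.2 + z * c.2))
    - (b.2 - (x * a.2 + y * b.2 + z * c.2)) * (c.1 - (x * a.1 + y * b.1 + z * c.1)) = x * d.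
    by rewrite xE dE; ring.
  have -> : (c.1 - (x * a.1 + y * b.1 + z * c.1)) * (a.2 - (x * a.2 + y * b.2 + z * c.2))
    - (c.2 - (x * a.2 + y * b.2 + z * c.2)) * (a.1 - (x * a.1 + y * b.1 + z * c.1)) = y * d.
    by rewrite xE dE; ring.
  have -> : (a.1 - (x * a.1 + y * b.1 + z * c.1)) * (b.2 - (x * a.2 + y * b.2 + z * c.2))
    - (a.2 - (x * a.2 + y * b.2 + z * c.2)) * (b.1 - (x * a.1 + y * b.1 + z * c.1)) = z * d.
    by rewrite xE dE; ring.
  by rewrite !mulfK.
have d0' := d0; rewrite dE in d0'.
exists (bary b c p q), (bary c a p q), (bary a b p q); split => //.
  by rewrite /bary /signed_area /= dE; field.
by congr pair; rewrite /bary /signed_area /= dE;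
  rewrite /GRing.scale /=; field.
Qed.

Lemma area_shear {R : realType} (k l : R) {a b c : R^o * R^o} :
    signed_area a b c != 0 ->
  area (triangle (a.1, a.2 + k * a.1 + l) (b.1, b.2 + k * b.1 + l)
    (c.1, c.2 + k * c.1 + l)) = area (triangle a b c).
Proof.
move=> d0; apply: (@area_fiber_translation _ _ _ (fun x => - (k * x + l))).
  exact: measurable_triangle.
move=> x y; split=> -[u [v [w [u0 v0 w0 uvw [-> yE]]]]]; exists u, v, w; split=> //;
  have uE : u = 1 - v - w by rewrite -uvw; ring.
  by congr pair; rewrite yE /= /GRing.scale /= uE; ring.
have {}yE : y = u * a.2 + v * b.2 + w * c.2 + (k * (u * a.1 + v * b.1 + w * c.1) + l).
  by apply: (addIr (- (k * (u * a.1 + v * b.1 + w * c.1) + l))); rewrite addrK.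
congr pair; rewrite yE /= /GRing.scale /= uE; ring.
Qed.

Lemma area_transpose {R : realType} {a b c : R^o * R^o} :
    signed_area a b c != 0 ->
  area (triangle (a.2, a.1) (b.2, b.1) (c.2, c.1)) = area (triangle a b c).
Proof.
move=> d0; apply: area_swap; first exact: measurable_triangle.
by move=> x y; split=> -[u [v [w [u0 v0 w0 uvw [-> ->]]]]]; exists u, v, w; split.
Qed.

Lemma area_shear_horizontal {R : realType} (k l : R) {a b c : R^o * R^o} :
    signed_area a b c != 0 ->
  area (triangle (a.1 + k * a.2 + l, a.2) (b.1 + k * b.2 + l, b.2)
    (c.1 + k * c.2 + l, c.2)) = area (triangle a b c).
Proof.
move=> d0.
have d0' : signed_area (a.2, a.1) (b.2, b.1) (c.2, c.1) != 0.
  by move: d0; rewrite -oppr_eq0 /signed_area /= opprB.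
rewrite -(area_transpose d0) -(area_shear k l d0').
apply: (@area_transpose _ (a.2, a.1 + k * a.2 + l) (b.2, b.1 + k * b.2 + l)
  (c.2, c.1 + k * c.2 + l)).
rewrite (_ : signed_area _ _ _ = signed_area (a.2, a.1) (b.2, b.1) (c.2, c.1))//.
by rewrite /signed_area /=; ring.
Qed.

Lemma area_triangle_degenerate {R : realType} (a b c : R^o * R^o) :
  signed_area a b c = 0 -> area (triangle a b c) = 0%E.
Proof.
move=> d0.
have line (u v w : R) : (u != 0) || (v != 0) -> u * a.1 + v * a.2 = w ->
    u * b.1 + v * b.2 = w -> u * c.1 + v * c.2 = w -> area (triangle a b c) = 0%E.
  move=> uv aw bw cw; apply: (@area_sub_line _ _ _ _ w uv).
  move=> _ [x [y [z [_ _ _ xyz ->]]]] /=.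
  transitivity (x * (u * a.1 + v * a.2) + y * (u * b.1 + v * b.2)
    + z * (u * c.1 + v * c.2)); first by rewrite /GRing.scale /=; ring.
  by rewrite aw bw cw -!mulrDl xyz mul1r.
have [ba|ba] := boolP ((b.2 - a.2 != 0) || (a.1 - b.1 != 0)).
  apply: (line _ _ ((b.2 - a.2) * a.1 + (a.1 - b.1) * a.2) ba) => //; first ring.
  by apply/eqP; rewrite -subr_eq0 -oppr_eq0 -d0 /signed_area; apply/eqP; ring.
move: ba; rewrite negb_or !negbK !subr_eq0 => /andP[/eqP b2 /eqP b1].
have [ca|ca] := boolP ((c.2 - a.2 != 0) || (a.1 - c.1 != 0)).
  by apply: (line _ _ ((c.2 - a.2) * a.1 + (a.1 - c.1) * a.2) ca) => //;
    rewrite ?b2 -?b1; ring.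
move: ca; rewrite negb_or !negbK !subr_eq0 => /andP[/eqP c2 /eqP c1].
by apply: (line 1 0 a.1); rewrite ?oner_eq0// -?b1 -?c1; ring.
Qed.

Lemma area_triangle_normal_form {R : realType} {a b c : R^o * R^o} :
    signed_area a b c != 0 ->
  area (triangle a b c) =
  area (triangle (0, 0) (1, 0) (0, signed_area a b c)).
Proof.
have V (k p q s t : R) : p * t - q * s != 0 ->
    area (triangle (0, 0) (p, q) (s, t)) =
    area (triangle (0, 0) (p, q + k * p) (s, t + k * s)).
  move=> d0; have d0' : signed_area (0, 0) (p, q) (s, t) != 0.
    by rewrite /signed_area /= !subr0.
  by rewrite -(area_shear k 0 d0') /= mulr0 !addr0.
have H (k p q s t : R) : p * t - q * s != 0 ->
    area (triangle (0, 0) (p, q) (s, t)) =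
    area (triangle (0, 0) (p + k * q, q) (s + k * t, t)).
  move=> d0; have d0' : signed_area (0, 0) (p, q) (s, t) != 0.
    by rewrite /signed_area /= !subr0.
  by rewrite -(area_shear_horizontal k 0 d0') /= mulr0 !addr0.
have at_origin (p q s t : R) : q != 0 -> p * t - q * s != 0 ->
    area (triangle (0, 0) (p, q) (s, t)) =
    area (triangle (0, 0) (1, 0) (0, p * t - q * s)).
  move=> q0; set d := p * t - q * s => d0.
  rewrite (H ((1 - p) / q))//.
  have -> : p + (1 - p) / q * q = 1 by field.
  set s' := s + _.
  have dE : 1 * t - q * s' = d by rewrite /s' /d; field.
  rewrite (V (- q)) ?dE//.
  have -> : q + - q * 1 = 0 by ring.
  have -> : t + - q * s' = d by rewrite -dE; ring.
  rewrite (H (- s' / d)); last by rewrite mul0r subr0 mul1r.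
  have -> : s' + - s' / d * d = 0 by field.
  by rewrite mulr0 addr0.
move=> d0.
have -> : area (triangle a b c) = area (triangle (0, 0)
    (b.1 - a.1, b.2 - a.2) (c.1 - a.1, c.2 - a.2)).
  rewrite -(area_shear 0 (- a.2) d0) /=.
  rewrite -(area_shear_horizontal 0 (- a.1)) /=; last first.
    by rewrite /signed_area /= (_ : _ - _ = signed_area a b c)// /signed_area; ring.
  by rewrite !mul0r !addr0 !subrr.
move: d0; rewrite /signed_area; set p := b.1 - _; set q := b.2 - _.
set s := c.1 - _; set t := c.2 - _ => d0.
have [q0|q0] := eqVneq q 0; last exact: at_origin.
have p0 : p != 0.
  by apply: contraNneq d0 => p0; rewrite p0 q0 !mul0r subrr.
have dE : p * (t + 1 * s) - (q + 1 * p) * s = p * t - q * s by ring.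
by rewrite (V 1)// at_origin ?dE// q0 add0r mul1r.
Qed.

Lemma area_triangle_eq {R : realType} (a b c a' b' c' : R^o * R^o) :
    signed_area a b c = signed_area a' b' c' ->
  area (triangle a b c) = area (triangle a' b' c').
Proof.
move=> dd; have [d0|d0] := eqVneq (signed_area a b c) 0.
  by rewrite !area_triangle_degenerate// -dd.
have d0' : signed_area a' b' c' != 0 by rewrite -dd.
by rewrite (area_triangle_normal_form d0) (area_triangle_normal_form d0') dd.
Qed.

Definition derivative_within {R : realType} (I : set R) (f : R -> R) (t l : R) :=
  (fun s => (s - t)^-1 * (f s - f t)) @ within I t^' --> l.

Lemma derivative_within_is_derive {R : realType} {I : set R} {f : R -> R} {t l : R} :
  nbhs t I -> derivative_within I f t l -> is_derive t 1 (f : R^o -> R^o) l.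
Proof.
move=> It fl.
suff h : (fun h => h^-1 *: (((f : R^o -> R^o) \o shift t) (h *: (1 : R^o)) - f t)) @ 0^' --> l.
  by split; [apply/cvg_ex; exists l | exact: cvg_lim].
move=> P /fl nP.
have : \forall s \near t, s != t -> P ((s - t)^-1 * (f s - f t)).
  have nP' : nbhs t (fun s => s != t -> I s -> P ((s - t)^-1 * (f s - f t))) := nP.
  by apply: filterS2 It nP' => s Is /[swap] st /(_ st); exact.
rewrite (near_shift 0) => nQ.
have nQ' : nbhs (0 : R) (fun h => h != 0 -> P (h^-1 *: (f (h *: 1 + t) - f t))).
  apply: filterS nQ => h /=; rewrite subr0 addrK => H h0.
  rewrite /GRing.scale /= mulr1; apply: H.
  by rewrite -subr_eq0 addrK.
exact: nQ'.
Qed.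

Lemma derivative_within_cvg {R : realType} {I : set R} {f : R -> R} {t l : R} :
  derivative_within I f t l -> f @ within I (nbhs t) --> f t.
Proof.
move=> fl; apply/cvgrPdist_lt => e e0.
have l0 : 0 < `|l| + 1 by rewrite ltr_wpDl.
have : \forall s \near within I t^', `|l - (s - t)^-1 * (f s - f t)| < 1.
  by move/cvgrPdist_lt : fl; apply.
move=> q.
have q' : nbhs t (fun s => s != t -> I s -> `|l - (s - t)^-1 * (f s - f t)| < 1) := q.
have d : nbhs t (fun s : R => `|t - s| < e / (`|l| + 1)).
  by apply: nbhsx_ballx; rewrite divr_gt0.
suff : nbhs t (fun s => I s -> `|f t - f s| < e) by [].
apply: filterS2 q' d => s qs ds Is.
have [->|st] := eqVneq s t; first by rewrite subrr normr0.
have st0 : s - t != 0 by rewrite subr_eq0.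
have -> : f t - f s = (t - s) * ((s - t)^-1 * (f s - f t)) by field.
set u := _^-1 * _ in qs *.
rewrite normrM -[e](divfK (lt0r_neq0 l0)).
apply: ltr_pM => //.
have := qs st Is; rewrite -/u => lu.
rewrite -[u](subKr l) (le_lt_trans (ler_normB _ _))// ltrD2l.
by rewrite lu.
Qed.

Lemma cvg_fst_snd {R : realType} {T : Type} (F : set_system T) {FF : Filter F}
    (f : T -> R^o * R^o) (l : R^o * R^o) :
  f @ F --> l -> (fun s => (f s).1) @ F --> l.1 /\ (fun s => (f s).2) @ F --> l.2.
Proof.
move=> fl.
split; [apply: (cvg_comp _ fst fl)|apply: (cvg_comp _ snd fl)].
  exact: cvg_fst.
exact: cvg_snd.
Qed.

Lemma ruleB_signed_area_constant {R : realType} (I : set R) (r v : 'Z_3 -> R -> R^o * R^o) :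
    is_interval I ->
    (forall i, continuously_differentiable_on I (r i) (v i)) ->
    (forall t, I t -> ruleB r v t) ->
  forall s t, I s -> I t ->
    signed_area (r 0 s) (r 1 s) (r 2 s) = signed_area (r 0 t) (r 1 t) (r 2 t).
Proof.
move=> hI hrv hB.
pose D t := signed_area (r 0 t) (r 1 t) (r 2 t).
have der i t : I t -> derivative_within I (fun s => (r i s).1) t (v i t).1 /\
    derivative_within I (fun s => (r i s).2) t (v i t).2.
  by move=> It; have /(_ _ It)/cvg_fst_snd := (hrv i).1.
suff lt_const s t : I s -> I t -> s < t -> D s = D t.
  move=> s t Is It; have [st|ts|->//] := ltgtP s t; first exact: lt_const.
  by apply/esym; exact: lt_const.
move=> Is It st.
have sI : `[s, t]%classic `<=` I.
  by move=> x /=; rewrite in_itv /=; exact: hI Is It _.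
have Dc : {within `[s, t], continuous D}.
  apply/subspace_continuousP => x /sI Ix.
  have c1 i := derivative_within_cvg (der i x Ix).1.
  have c2 i := derivative_within_cvg (der i x Ix).2.
  apply: (@cvg_trans _ (D @ within I (nbhs x))).
    by apply: cvg_app; exact: within_subset.
  apply: cvgB; apply: cvgM; apply: cvgB => //.
have D' x : x \in `]s, t[ -> is_derive x 1 (D : R^o -> R^o) 0.
  move=> xst.
  have nI : nbhs x I.
    apply: filterS (near_in_itvoo xst) => y yst; apply: sI.
    by apply: subset_itv_oo_cc.
  have Ix := nbhs_singleton nI.
  have d1 i := derivative_within_is_derive nI (der i x Ix).1.
  have d2 i := derivative_within_is_derive nI (der i x Ix).2.
  apply: is_derive_eq.
  have := hB x Ix 2; have := hB x Ix 1; have := hB x Ix 0.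
  have -> : 1 + 1 = 2 :> 'Z_3 by exact: val_inj.
  have -> : 1 + 2 = 0 :> 'Z_3 by exact: val_inj.
  have -> : 2 + 1 = 0 :> 'Z_3 by exact: val_inj.
  have -> : 2 + 2 = 1 :> 'Z_3 by exact: val_inj.
  rewrite !add0r => e0 e1 e2.
  have -> : 0 = 0 + 0 + 0 :> R by rewrite !addr0.
  by rewrite -{1}e0 -[X in _ + X + _]e1 -[X in _ + _ + X]e2 /GRing.scale /=; ring.
have [c _] := MVT st D' Dc.
by rewrite mul0r => /esym/eqP; rewrite eq_sym subr_eq0 => /eqP.
Qed.

Theorem proposition3p1 (R : realType) (I : set R) (hI : is_interval I)
    (r v : 'Z_3 -> R -> R^o * R^o)
    (hrv : forall i, continuously_differentiable_on I (r i) (v i))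
    (hB : forall t, I t -> ruleB r v t) :
  forall s t, I s -> I t ->
    area (triangle (r 0 s) (r 1 s) (r 2 s)) =
    area (triangle (r 0 t) (r 1 t) (r 2 t)).
Proof.
move=> s t Is It; apply: area_triangle_eq.
exact: ruleB_signed_area_constant hI hrv hB s t Is It.
Qed.
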